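(* Let $(\mathbb{X}, \|\cdot\|)$ be a finite dimensional real normed linear space. Then $\mathbb{X}$ is an inner product space (i.e., its norm is induced by an inner product) if and only if for all $x, y \in S_{\mathbb{X}}$ with $x \perp_B y$ and for all real $\lambda$ with $|\lambda| \in (3-2\sqrt{2}, \sqrt{2}+1)$ we have $$\frac{1+|\lambda|}{\|y+\lambda x\|} \leq \sqrt{2}.$$
   Context: $S_{\mathbb{X}} = \{x \in \mathbb{X} : \|x\| = 1\}$ is the unit sphere of $\mathbb{X}$. For $x,y \in \mathbb{X}$, $x$ is Birkhoff-James orthogonal to $y$, written $x \perp_B y$, if $\|x\| \leq \|x+\alpha y\|$ for all $\alpha \in \mathbb{R}$. *)

(* Defs.v *)
From HB Require Import structures.
From mathcomp Require Import all_boot all_order all_algebra.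
From mathcomp Require Import sesquilinear.
From mathcomp Require Import all_classical all_reals.
From mathcomp Require Import topology tvs normedtype.

Set Implicit Arguments.
Unset Strict Implicit.
Unset Printing Implicit Defensive.

Import Order.TTheory GRing.Theory Num.Theory.
Import numFieldNormedType.Exports.

Local Open Scope classical_set_scope.
Local Open Scope ring_scope.

(* The norm comes from NormedModule and finite dimension from Vector; both share
   one and the same Lmodule structure.  Every dimension is allowed, 0 included. *)
#[short(type="finNormedModType")]
HB.structure Definition FinNormedModule (K : numFieldType) :=
  {V of NormedModule K V & Vector K V}.

Definition unit_sphere {R : realType} (V : normedModType R) : set V :=
  [set x : V | `|x| = 1].
Arguments unit_sphere {R} V _.

Definition birkhoff_james_orthogonal {R : realType} {V : normedModType R}
    (x y : V) : Prop :=
  forall a : R, `|x| <= `|x + a *: y|.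

(* {dot V for idfun} is the type of symmetric, bilinear, positive definite forms
   V -> V -> R: over the reals the conjugation theta is the identity. *)
Definition is_inner_product_space {R : realType} (V : normedModType R) : Prop :=
  exists dotp : {dot V for idfun}, forall x : V, `|x| = Num.sqrt (dotp x x).

(* Main.v *)
(* Outside the range of lambda in the theorem the inequality is automatic, so the
   condition says that ||v|| + ||w|| <= sqrt 2 ||v + w|| whenever v is orthogonal to
   w ("rectangular" below); it suffices to show that the norm is Euclidean on each
   plane spanned by independent vectors.  By compactness some orthogonal pair (x, y)
   of unit vectors of the plane spans the smallest area.  The rectangular condition
   bounds from below the norm of x - y and the distance from 0 to the line through
   x and y; if one of these bounds were strict, x - y and the vector orthogonal to it
   would span a smaller area.  Hence ((x + y) / sqrt 2, (y - x) / sqrt 2) is again a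
   minimal pair.  So the unit sphere passes, with the tangents of the circle, through
   the vertices of a regular octagon of the Euclidean structure with orthonormal
   basis (x, y).  Near these vertices the rectangular condition bounds the slope of
   the deviation of the norm from the Euclidean one by the size of the deviation at
   the eight points turned by the same angle; by a Gronwall argument the norm is
   Euclidean near the vertices.  Nearby rotated pairs are therefore minimal as well,
   and the set of good rotation angles is open and closed, hence everything. *)

Require Import Defs.
From HB Require Import structures.
From mathcomp Require Import all_boot all_order all_algebra.
From mathcomp Require Import sesquilinear.
From mathcomp Require Import ring lra.
From mathcomp Require Import all_classical all_reals.
From mathcomp Require Import topology tvs normedtype.
From mathcomp Require Import derive trigo.

Set Implicit Arguments.
Unset Strict Implicit.
Unset Printing Implicit Defensive.

Import Order.TTheory GRing.Theory Num.Theory.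
Import numFieldNormedType.Exports.

Local Open Scope classical_set_scope.
Local Open Scope ring_scope.

(** * Norms on the plane and minimal orthogonal pairs *)

Definition norm2 (R : realType) (N : R -> R -> R) : Prop :=
  [/\ forall c a b, N (c * a) (c * b) = `|c| * N a b,
      forall a b c d, N (a + c) (b + d) <= N a b + N c d &
      forall a b, N a b = 0 -> a = 0 /\ b = 0].

Definition bj2 (R : realType) (N : R -> R -> R) (a b c d : R) : Prop :=
  forall s, N a b <= N (a + s * c) (b + s * d).

Definition rectangular (R : realType) (N : R -> R -> R) : Prop :=
  forall a b c d, bj2 N a b c d ->
    N a b + N c d <= Num.sqrt 2 * N (a + c) (b + d).

(* The standard basis is a Birkhoff-James orthogonal pair of unit vectors that
   spans the smallest area among all such pairs. *)
Definition min_pair (R : realType) (N : R -> R -> R) : Prop :=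
  [/\ N 1 0 = 1, N 0 1 = 1, bj2 N 1 0 0 1 &
      forall a b c d, bj2 N a b c d -> N a b * N c d <= `|a * d - b * c|].

(** The norm in the coordinates of the basis [(p, r)], [(q, s)]: the matrix is listed row by row,
    and the new basis vectors are its columns. *)
Definition lin2 (R : realType) (N : R -> R -> R) (p q r s : R) : R -> R -> R :=
  fun a b => N (p * a + q * b) (r * a + s * b).

Lemma sqrt2_gt0 (R : realType) : 0 < Num.sqrt 2 :> R.
Proof. by rewrite sqrtr_gt0. Qed.

Lemma sqrt2_sqr (R : realType) : Num.sqrt 2 * Num.sqrt 2 = 2 :> R.
Proof. by rewrite -expr2 sqr_sqrtr. Qed.

Lemma norm2_00 (R : realType) (N : R -> R -> R) : norm2 N -> N 0 0 = 0.
Proof. by case=> h _ _; have := h 0 0 0; rewrite !mul0r normr0 mul0r. Qed.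

Lemma norm2N (R : realType) (N : R -> R -> R) a b :
  norm2 N -> N (- a) (- b) = N a b.
Proof. by case=> h _ _; rewrite -mulN1r -(mulN1r b) h normrN1 mul1r. Qed.

Lemma norm2_ge0 (R : realType) (N : R -> R -> R) a b : norm2 N -> 0 <= N a b.
Proof.
move=> hN; case: (hN) => _ tri _; have := tri a b (- a) (- b).
by rewrite !subrr norm2_00 // norm2N //; lra.
Qed.

Lemma norm2_gt0 (R : realType) (N : R -> R -> R) a b :
  norm2 N -> (a != 0) || (b != 0) -> 0 < N a b.
Proof.
move=> hN hab; rewrite lt_neqAle norm2_ge0 // andbT eq_sym; apply/eqP => h0.
by case: hN => _ _ /(_ _ _ h0) [a0 b0]; move: hab; rewrite a0 b0 eqxx.
Qed.

Lemma norm2_posZ (R : realType) (N : R -> R -> R) c a b :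
  norm2 N -> 0 <= c -> N (c * a) (c * b) = c * N a b.
Proof. by case=> h _ _ c0; rewrite h ger0_norm. Qed.

Lemma norm2_lin2 (R : realType) (N : R -> R -> R) p q r s :
  p * s - q * r != 0 -> norm2 N -> norm2 (lin2 N p q r s).
Proof.
move=> dt [hZ hD h0]; split.
- by move=> c a b; rewrite /lin2 -hZ; congr (N _ _); ring.
- by move=> a b c d; rewrite /lin2; apply: le_trans (hD _ _ _ _);
    rewrite le_eqVlt; apply/orP; left; apply/eqP; congr (N _ _); ring.
- move=> a b /h0 [e1 e2]; split; apply: (mulfI dt).
    have -> : (p * s - q * r) * a = s * (p * a + q * b) - q * (r * a + s * b) by ring.
    by rewrite e1 e2; ring.
  have -> : (p * s - q * r) * b = p * (r * a + s * b) - r * (p * a + q * b) by ring.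
  by rewrite e1 e2; ring.
Qed.

Lemma bj2_lin2 (R : realType) (N : R -> R -> R) p q r s a b c d :
  bj2 (lin2 N p q r s) a b c d <->
  bj2 N (p * a + q * b) (r * a + s * b) (p * c + q * d) (r * c + s * d).
Proof.
have e u : lin2 N p q r s (a + u * c) (b + u * d) =
    N (p * a + q * b + u * (p * c + q * d)) (r * a + s * b + u * (r * c + s * d)).
  by rewrite /lin2; congr (N _ _); ring.
by split=> h u; [rewrite -e|rewrite e]; apply: h.
Qed.

Lemma rectangular_lin2 (R : realType) (N : R -> R -> R) p q r s :
  rectangular N -> rectangular (lin2 N p q r s).
Proof.
move=> h a b c d /bj2_lin2 /h; rewrite /lin2.
have -> : N (p * a + q * b + (p * c + q * d)) (r * a + s * b + (r * c + s * d)) =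
  N (p * (a + c) + q * (b + d)) (r * (a + c) + s * (b + d)) by congr (N _ _); ring.
by [].
Qed.

(* By convexity it suffices to test Birkhoff-James orthogonality locally. *)
Lemma bj2_local (R : realType) (N : R -> R -> R) a b c d e :
  norm2 N -> 0 < e ->
  (forall s, `|s| <= e -> N a b <= N (a + s * c) (b + s * d)) -> bj2 N a b c d.
Proof.
move=> hN e0 h s; case: (hN) => _ tri _.
have se : 0 < `|s| + e by rewrite ltr_wpDl.
pose l := e / (`|s| + e).
have l0 : 0 < l by rewrite divr_gt0.
have l1 : l <= 1 by rewrite ler_pdivrMr // mul1r lerDr.
have := h (l * s); rewrite normrM (gtr0_norm l0).
have -> : l * `|s| <= e.
  by rewrite mulrAC ler_pdivrMr // ler_wpM2l ?(ltW e0) // lerDl ltW.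
move=> /(_ isT).
have -> : N (a + l * s * c) (b + l * s * d) =
  N ((1 - l) * a + l * (a + s * c)) ((1 - l) * b + l * (b + s * d)).
  by congr (N _ _); ring.
move=> h1; have := le_trans h1 (tri _ _ _ _).
rewrite !norm2_posZ ?subr_ge0 ?(ltW l0) // => h2.
by rewrite -(ler_pM2l l0); lra.
Qed.

Lemma bj2Z (R : realType) (N : R -> R -> R) a b c d k m :
  norm2 N -> bj2 N a b c d -> bj2 N (k * a) (k * b) (m * c) (m * d).
Proof.
move=> hN h s; have [->|k0] := eqVneq k 0.
  by rewrite !mul0r norm2_00 // norm2_ge0.
case: (hN) => hZ _ _; have := h (s * m / k).
rewrite -(ler_pM2l (x := `|k|)) ?normr_gt0 // -!hZ.
have -> : N (k * (a + s * m / k * c)) (k * (b + s * m / k * d)) =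
  N (k * a + s * (m * c)) (k * b + s * (m * d)) by congr (N _ _); field.
by [].
Qed.

(** A map of determinant [1] or [-1] preserves areas, so the minimality of the area carries over to
    the new basis. *)
Lemma min_pair_lin2 (R : realType) (N : R -> R -> R) p q r s :
  min_pair N -> N p r = 1 -> N q s = 1 -> bj2 N p r q s ->
  `|p * s - q * r| = 1 -> min_pair (lin2 N p q r s).
Proof.
case=> _ _ _ hm h1 h2 h3 hd; split.
- by rewrite /lin2 !mulr1 !mulr0 !addr0.
- by rewrite /lin2 !mulr1 !mulr0 !add0r.
- by apply/bj2_lin2; rewrite !mulr1 !mulr0 !addr0 !add0r.
- move=> a b c d /bj2_lin2 /hm /le_trans; apply.
  rewrite (_ : _ - _ = (p * s - q * r) * (a * d - b * c)); last by ring.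
  by rewrite normrM hd mul1r.
Qed.

(* Rectangularity for the orthogonal vectors (a, 0) and (0, b). *)
Lemma min_pair_rhombus (R : realType) (N : R -> R -> R) a b :
  norm2 N -> rectangular N -> min_pair N ->
  `|a| + `|b| <= Num.sqrt 2 * N a b.
Proof.
move=> hN hr [h1 h2 hb _]; case: (hN) => hZ _ _.
have := hr _ _ _ _ (bj2Z a b hN hb).
by rewrite !hZ h1 h2 !mulr1 !mulr0 add0r addr0.
Qed.

Lemma norm2_dist (R : realType) (N : R -> R -> R) a b c d :
  norm2 N -> `|N a b - N c d| <= `|a - c| * N 1 0 + `|b - d| * N 0 1.
Proof.
move=> hN; case: (hN) => hZ hD _.
have h u v : N u v <= `|u| * N 1 0 + `|v| * N 0 1.
  by rewrite -!hZ !mulr1 !mulr0; have := hD u 0 0 v; rewrite addr0 add0r.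
have h1 := hD (a - c) (b - d) c d; have h2 := hD (c - a) (d - b) a b.
have := h (a - c) (b - d); have := h (c - a) (d - b).
rewrite !subrK in h1 h2; rewrite (distrC c) (distrC d) ler_norml => h3 h4.
by apply/andP; split; lra.
Qed.

Lemma norm2_cvg (R : realType) (N : R -> R -> R) (T : Type) (F : set_system T)
    (f g : T -> R) (a b : R) :
  norm2 N -> Filter F -> f @ F --> a -> g @ F --> b ->
  (fun t => N (f t) (g t)) @ F --> N a b.
Proof.
move=> hN FF fa gb; apply/cvgrPdist_le => e e0.
pose K := N 1 0 + N 0 1 + 1.
have [n1 n2] : 0 <= N 1 0 /\ 0 <= N 0 1 by split; apply: norm2_ge0.
have K0 : 0 < K by rewrite /K; lra.
have eK : 0 < e / K by apply: divr_gt0.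
near=> t.
apply: le_trans (norm2_dist _ _ _ _ hN) _.
have h1 : `|a - f t| <= e / K by near: t; move/cvgrPdist_le : fa; apply.
have h2 : `|b - g t| <= e / K by near: t; move/cvgrPdist_le : gb; apply.
apply: (@le_trans _ _ (e / K * N 1 0 + e / K * N 0 1)).
  by apply: lerD; apply: ler_wpM2r.
by rewrite -mulrDr mulrAC ler_pdivrMr // ler_pM2l // /K; lra.
Unshelve. all: by end_near. Qed.

(** A point of a line that is closest to the origin is orthogonal to the direction of the line. *)
Lemma bj2_exists (R : realType) (N : R -> R -> R) a b c d :
  norm2 N -> exists t, bj2 N (a + t * c) (b + t * d) c d.
Proof.
move=> hN; case: (hN) => hZ hD h0.
have [cd0|cd0] := eqVneq (N c d) 0.
  have [-> ->] := h0 _ _ cd0.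
  by exists 0 => s; rewrite !mulr0 !addr0.
have cdp : 0 < N c d by rewrite lt_neqAle eq_sym cd0 norm2_ge0.
have ab0 : 0 <= N a b by apply: norm2_ge0.
(* For [|u| > L] the triangle inequality makes the norm at parameter [u] exceed [N a b], its value
   at [u = 0]; hence a minimum over [[-L, L]] is global. *)
pose L := 2 * N a b / N c d.
have L0 : 0 <= L by apply: divr_ge0; [lra|exact: ltW].
pose f u := N (a + u * c) (b + u * d).
have cf : continuous f.
  move=> u; apply: norm2_cvg => //; apply: cvgD; try exact: cvg_cst;
    by apply: cvgM; [exact: cvg_id|exact: cvg_cst].
have LL : - L <= L by lra.
have [t /= tL tmin] := EVT_min LL (continuous_subspaceT cf).
have f0 : f t <= N a b.
  by have := tmin 0; rewrite /f !mul0r !addr0; apply; rewrite in_itv /=; lra.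
exists t => s.
have -> : N (a + t * c + s * c) (b + t * d + s * d) = f (t + s).
  by rewrite /f; congr (N _ _); ring.
have [uL|uL] := lerP `|t + s| L.
  by apply: tmin; rewrite in_itv /= -ler_norml.
apply: le_trans f0 _.
have := hD (a + (t + s) * c) (b + (t + s) * d) (- a) (- b).
rewrite norm2N // (_ : _ + - a = (t + s) * c); last by ring.
rewrite (_ : _ + - b = (t + s) * d); last by ring.
rewrite hZ -/(f _) => h1.
have : L * N c d <= `|t + s| * N c d by rewrite ler_pM2r // ltW.
by rewrite /L divfK //; lra.
Qed.

(** The point of the line through [(1, 0)] and [(0, 1)] that is orthogonal to [(1, -1)] spans area
    [1] with this vector, so by minimality the product of the two norms is at most [1]. The rhombus
    inequality bounds the two norms from below by [1 / sqrt 2] and [sqrt 2], which forces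
    equality. *)
Lemma min_pair_diag (R : realType) (N : R -> R -> R) :
  norm2 N -> rectangular N -> min_pair N -> N 1 (-1) = Num.sqrt 2.
Proof.
move=> hN hr hm; case: (hm) => h1 h2 hb hmin.
have r0 := sqrt2_gt0 R; have rr := sqrt2_sqr R.
have n0 := norm2_ge0 1 (-1) hN.
have h3 := min_pair_rhombus 1 (-1) hN hr hm.
rewrite normr1 normrN1 in h3.
have [t ht] := bj2_exists 1 0 1 (-1) hN.
have := hmin _ _ _ _ ht.
rewrite (_ : _ - _ = -1) ?normrN1; last by ring.
have h4 := min_pair_rhombus (1 + t * 1) (0 + t * -1) hN hr hm.
have h5 : 1 <= `|1 + t * 1| + `|0 + t * -1|.
  have := ler_norm (1 + t * 1); have := ler_norm (0 + t * -1); lra.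
move: h4 h5 n0 h3 r0 rr.
by move: (N (1 + t * 1) _) (N 1 _) (Num.sqrt 2) (`|_| + _) => u v w z; nra.
Qed.

(** * Minimal pairs turned by 45 degrees: the vertices of the octagon *)

Definition rot45 (R : realType) (N : R -> R -> R) : R -> R -> R :=
  let w := (Num.sqrt 2)^-1 in lin2 N w (- w) w w.

Lemma invsqrt2_gt0 (R : realType) : 0 < (Num.sqrt 2)^-1 :> R.
Proof. by rewrite invr_gt0 sqrt2_gt0. Qed.

Lemma invsqrt2_sqr (R : realType) :
  (Num.sqrt 2)^-1 * (Num.sqrt 2)^-1 = 2^-1 :> R.
Proof. by rewrite -invfM sqrt2_sqr. Qed.

Lemma rot45_det (R : realType) :
  (Num.sqrt 2)^-1 * (Num.sqrt 2)^-1 - - (Num.sqrt 2)^-1 * (Num.sqrt 2)^-1 = 1 :> R.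
Proof. by rewrite mulNr invsqrt2_sqr; lra. Qed.

Lemma norm2_rot45 (R : realType) (N : R -> R -> R) : norm2 N -> norm2 (rot45 N).
Proof. by apply: norm2_lin2; rewrite rot45_det oner_eq0. Qed.

Lemma rectangular_rot45 (R : realType) (N : R -> R -> R) :
  rectangular N -> rectangular (rot45 N).
Proof. exact: rectangular_lin2. Qed.

Lemma rot45_rot45 (R : realType) (N : R -> R -> R) a b :
  rot45 (rot45 N) a b = N (- b) a.
Proof.
rewrite /rot45 /lin2; set w := _^-1.
have ww : w * w = 2^-1 := invsqrt2_sqr R.
have e : w * w + w * w = 1 by lra.
by congr (N _ _); [rewrite -[in RHS](mul1r b)|rewrite -[RHS]mul1r]; rewrite -e; ring.
Qed.

(** Four turns make a half turn, which a norm does not see; so four frames serve for all eight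
    vertices of the octagon. *)
Lemma rot45_4 (R : realType) (N : R -> R -> R) a b :
  norm2 N -> rot45 (rot45 (rot45 (rot45 N))) a b = N a b.
Proof. by move=> hN; rewrite !rot45_rot45 norm2N. Qed.

(** Transfers statements to the other diagonal, and from positive to negative slopes. *)
Lemma min_pair_reflect (R : realType) (N : R -> R -> R) :
  norm2 N -> min_pair N -> min_pair (lin2 N 1 0 0 (-1)).
Proof.
move=> hN hm; case: (hm) => h1 h2 hb _; apply: min_pair_lin2 => //.
- by rewrite -(norm2N 0 (-1) hN) oppr0 opprK.
- by have := bj2Z 1 (-1) hN hb; rewrite !mulr0 !mulr1.
- by rewrite mul1r mul0r subr0 normrN1.
Qed.

(** Both diagonals have length [sqrt 2], which gives the unit lengths. On the line through the first
    new vector in the direction of the second, the sum of the coordinates is constantly [sqrt 2], so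
    the rhombus inequality keeps the norm at least [1] there: this is the orthogonality. *)
Lemma min_pair_rot45 (R : realType) (N : R -> R -> R) :
  norm2 N -> rectangular N -> min_pair N -> min_pair (rot45 N).
Proof.
move=> hN hr hm.
have w0 := invsqrt2_gt0 R; have ww := invsqrt2_sqr R.
have rw : Num.sqrt 2 * (Num.sqrt 2)^-1 = 1 :> R.
  by rewrite divff // gt_eqF // sqrt2_gt0.
have d1 := min_pair_diag hN hr hm.
have d2 : N 1 1 = Num.sqrt 2.
  have hN' : norm2 (lin2 N 1 0 0 (-1)).
    by apply: norm2_lin2 => //; rewrite mul1r mul0r subr0 oppr_eq0 oner_eq0.
  have hr' : rectangular (lin2 N 1 0 0 (-1)) by exact: rectangular_lin2.
  have := min_pair_diag hN' hr' (min_pair_reflect hN hm).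
  by rewrite /lin2 !mul1r !mul0r addr0 add0r mulrNN mulr1.
have e1 : N (Num.sqrt 2)^-1 (Num.sqrt 2)^-1 = 1.
  by rewrite -[X in N X X]mulr1 norm2_posZ ?d2 1?mulrC ?rw // ltW.
rewrite /rot45; apply: min_pair_lin2 => //.
- by rewrite -mulrN1 -{2}[_^-1]mulr1 norm2_posZ // ?(ltW w0) //
    -(norm2N _ _ hN) opprK d1 mulrC.
- move=> s; rewrite e1.
  have := min_pair_rhombus ((Num.sqrt 2)^-1 + s * - (Num.sqrt 2)^-1)
     ((Num.sqrt 2)^-1 + s * (Num.sqrt 2)^-1) hN hr hm.
  have r0 := sqrt2_gt0 R.
  rewrite -(ler_pM2l r0 1) mulr1; apply: le_trans.
  have := ler_norm ((Num.sqrt 2)^-1 + s * - (Num.sqrt 2)^-1).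
  have := ler_norm ((Num.sqrt 2)^-1 + s * (Num.sqrt 2)^-1).
  suff : Num.sqrt 2 = 2 * (Num.sqrt 2)^-1 :> R by lra.
  by rewrite -{2}(sqrt2_sqr R) mulfK // gt_eqF.
- by rewrite rot45_det normr1.
Qed.

(** Two turns by 45 degrees take the basis to [(0, 1)], [(-1, 0)], which is therefore again an
    orthogonal pair. *)
Lemma min_pair_bj2_sym (R : realType) (N : R -> R -> R) :
  norm2 N -> rectangular N -> min_pair N -> bj2 N 0 1 1 0.
Proof.
move=> hN hr hm s.
have [_ _ hb _] : min_pair (rot45 (rot45 N)).
  by apply: min_pair_rot45;
    [exact: norm2_rot45|exact: rectangular_rot45|exact: min_pair_rot45].
have := hb (- s); rewrite !rot45_rot45 oppr0.
by congr (_ <= N _ _); ring.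
Qed.

(* Another tangent direction (s, 1) at (1, 0) would again give a pair of minimal
   area, and the diagonals of the parallelograms of both pairs have length sqrt 2. *)
Lemma min_pair_smooth (R : realType) (N : R -> R -> R) s :
  norm2 N -> rectangular N -> min_pair N -> bj2 N 1 0 s 1 -> s = 0.
Proof.
move=> hN hr hm hs; case: (hm) => h1 h2 hb hmin.
have hS := min_pair_bj2_sym hN hr hm.
have s1 : N s 1 = 1.
  apply/eqP; rewrite eq_le; apply/andP; split.
    by have := hmin _ _ _ _ hs; rewrite h1 mul1r mulr1 mul0r subr0 normr1.
  by have := hS s; rewrite h2 mulr0 add0r addr0 mulr1.
have hN' : norm2 (lin2 N 1 s 0 1).
  by apply: norm2_lin2 => //; rewrite mulr1 mulr0 subr0 oner_eq0.
have hm' : min_pair (lin2 N 1 s 0 1).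
  by apply: min_pair_lin2 => //; rewrite mulr1 mulr0 subr0 normr1.
have hr' : rectangular (lin2 N 1 s 0 1) by exact: rectangular_lin2.
have [e1 _ _ _] := min_pair_rot45 hN' hr' hm'.
have [_ e2 _ _] := min_pair_rot45 hN' hr' hm'.
move: e1 e2; rewrite /rot45 /lin2 => e1 e2.
(* With [w = 1 / sqrt 2], turning the sheared basis by 45 degrees yields the unit vectors
   [((1 + s) w, w)] and [((s - 1) w, w)]. The rhombus inequality forces [s <= 0] for the first and
   [0 <= s] for the second. *)
have := min_pair_rhombus _ _ hN hr hm => hR.
have := hR (1 * ((Num.sqrt 2)^-1 * 1 + - (Num.sqrt 2)^-1 * 0) +
      s * ((Num.sqrt 2)^-1 * 1 + (Num.sqrt 2)^-1 * 0)) 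
   (0 * ((Num.sqrt 2)^-1 * 1 + - (Num.sqrt 2)^-1 * 0) +
      1 * ((Num.sqrt 2)^-1 * 1 + (Num.sqrt 2)^-1 * 0)).
have := hR  (1 * ((Num.sqrt 2)^-1 * 0 + - (Num.sqrt 2)^-1 * 1) +
      s * ((Num.sqrt 2)^-1 * 0 + (Num.sqrt 2)^-1 * 1))
   (0 * ((Num.sqrt 2)^-1 * 0 + - (Num.sqrt 2)^-1 * 1) +
      1 * ((Num.sqrt 2)^-1 * 0 + (Num.sqrt 2)^-1 * 1)).
rewrite e1 e2 !mulr0 !mulr1 !mul0r !mul1r !addr0 !add0r.
set w := _^-1 => f1 f2.
have w0 : 0 < w := invsqrt2_gt0 R; have r0 := sqrt2_gt0 R.
have ww : w * w = 2^-1 := invsqrt2_sqr R.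
have e : Num.sqrt 2 = 2 * w by rewrite /w -{2}(sqrt2_sqr R) mulfK // gt_eqF.
rewrite (ger0_norm (ltW w0)) e in f1 f2.
have h3 : s * w <= 0 by have := ler_norm (w + s * w); lra.
have h4 : 0 <= s * w by have := ler_norm (- (- w + s * w)); rewrite normrN; lra.
by apply/eqP; rewrite eq_le; apply/andP; split; nra.
Qed.

(** By convexity a single point [(1, e)] with [N 1 e <= 1 + k * e] is enough. If there were none,
    [(-k, 1)] would be a second tangent direction at [(1, 0)], against smoothness. *)
Lemma min_pair_flat_right (R : realType) (N : R -> R -> R) k :
  norm2 N -> rectangular N -> min_pair N -> 0 < k ->
  exists2 e : R, 0 < e & forall t, 0 <= t <= e -> N 1 t <= 1 + k * t.
Proof.
move=> hN hr hm k0; case: (hm) => h1 h2 hb _; case: (hN) => hZ hD _.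
have [[e [e0 he]]|hno] := pselect (exists e, 0 < e /\ N 1 e <= 1 + k * e).
  exists e => // t /andP[t0 te].
  pose l := t / e.
  have l0 : 0 <= l by rewrite /l divr_ge0 // ltW.
  have l1 : l <= 1 by rewrite /l ler_pdivrMr // mul1r.
  have le : l * e = t by rewrite /l divfK // gt_eqF.
  have := hD ((1 - l) * 1) ((1 - l) * 0) (l * 1) (l * e).
  rewrite !norm2_posZ // ?subr_ge0 // h1 mulr0 add0r !mulr1 subrK le => h.
  by apply: le_trans h _; nra.
exfalso.
have hk t : 0 < t -> 1 + k * t < N 1 t.
  by move=> t0; rewrite ltNge; apply/negP => h; apply: hno; exists t.
suff /(min_pair_smooth hN hr hm) h : bj2 N 1 0 (- k) 1 by lra.
(* This radius keeps the first coordinate [1 - s * k] at least [1 / 2], so that the point can be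
   rescaled to the line of vectors [(1, y)]. *)
apply: (@bj2_local _ _ _ _ _ _ (2 * k)^-1) => //.
  by rewrite invr_gt0; lra.
move=> s hs; rewrite h1 add0r mulr1.
have sk : s * k <= 2^-1.
  have := ler_norm s; have : (2 * k)^-1 * k = 2^-1 by field; rewrite gt_eqF.
  by nra.
have d0 : 0 < 1 + s * - k by lra.
have -> : N (1 + s * - k) s = (1 + s * - k) * N 1 (s / (1 + s * - k)).
  by rewrite -norm2_posZ ?ltW // mulr1 [_ * (s / _)]mulrC divfK // gt_eqF.
(* For [s > 0], [hk] at [y = s / (1 - s * k)] applies, as [(1 - s * k) * (1 + k * y) = 1]. For
   [s <= 0] both factors are at least [1]. *)
have [s0|s0] := ltrP 0 s.
  have := hk (s / (1 + s * - k)); rewrite divr_gt0 // => /(_ isT) h.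
  have : (1 + s * - k) * (s / (1 + s * - k)) = s.
    by rewrite mulrC divfK // gt_eqF.
  move: h d0; move: (s / _) => y; move: (N 1 y) => x; nra.
have := hb (s / (1 + s * - k)); rewrite h1 mulr0 addr0 add0r mulr1.
move: d0; move: (N 1 _) => x; nra.
Qed.

Lemma min_pair_flat (R : realType) (N : R -> R -> R) k :
  norm2 N -> rectangular N -> min_pair N -> 0 < k ->
  exists2 e : R, 0 < e & forall t, `|t| <= e -> N 1 t <= 1 + k * `|t|.
Proof.
move=> hN hr hm k0.
have [e e0 he] := min_pair_flat_right hN hr hm k0.
have hN' : norm2 (lin2 N 1 0 0 (-1)).
  by apply: norm2_lin2 => //; rewrite mul1r mul0r subr0 oppr_eq0 oner_eq0.
have hr' : rectangular (lin2 N 1 0 0 (-1)) by exact: rectangular_lin2.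
have [e' e'0 he'] := min_pair_flat_right hN' hr' (min_pair_reflect hN hm) k0.
exists (Num.min e e'); first by rewrite lt_min e0.
move=> t; rewrite le_min => /andP[te te'].
have [t0|t0] := lerP 0 t.
  by rewrite (ger0_norm t0) in te *; apply: he; rewrite t0 te.
rewrite (ltr0_norm t0) in te te' *.
have := he' (- t); rewrite te' oppr_ge0 (ltW t0) => /(_ isT).
by rewrite /lin2 !mul1r !mul0r addr0 add0r mulrNN mul1r.
Qed.

(** The function [N 1] is convex, and [c] is its left derivative at [t]: the supremum of the slopes
    of the chords ending at [t], which are bounded by the slopes of the chords starting there. *)
Lemma subgradient (R : realType) (N : R -> R -> R) t : norm2 N ->
  exists c, forall s, N 1 t + c * (s - t) <= N 1 s.
Proof.
move=> hN; case: (hN) => _ hD _.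
have chord s u : s < t -> t < u ->
    (N 1 t - N 1 s) / (t - s) <= (N 1 u - N 1 t) / (u - t).
  move=> st tu.
  have [ts ut] : 0 < t - s /\ 0 < u - t by split; lra.
  have := hD ((u - t) * 1) ((u - t) * s) ((t - s) * 1) ((t - s) * u).
  rewrite (norm2_posZ 1 s hN (ltW ut)) (norm2_posZ 1 u hN (ltW ts)).
  have -> : N ((u - t) * 1 + (t - s) * 1) ((u - t) * s + (t - s) * u) = (u - s) * N 1 t.
    rewrite -(norm2_posZ (c := u - s) 1 t hN); last by lra.
    by congr (N _ _); ring.
  move=> h; rewrite ler_pdivrMr // mulrAC ler_pdivlMr //.
  by move: h; move: (N 1 _) (N 1 _) (N 1 _) => x y z; nra.
pose A := [set (N 1 t - N 1 s) / (t - s) | s in [set s | s < t]].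
have A0 : A !=set0 by exists ((N 1 t - N 1 (t - 1)) / (t - (t - 1))), (t - 1) => //=; lra.
have ubA u : t < u -> ubound A ((N 1 u - N 1 t) / (u - t)).
  by move=> tu _ [s /= st <-]; apply: chord.
have hA : has_sup A.
  by split=> //; exists ((N 1 (t + 1) - N 1 t) / (t + 1 - t)); apply: ubA; lra.
exists (sup A) => s.
have [st|ts|->] := ltgtP s t; last by rewrite subrr mulr0 addr0.
- have : (N 1 t - N 1 s) / (t - s) <= sup A.
    by apply: sup_upper_bound => //; exists s.
  by rewrite ler_pdivrMr ?subr_gt0 //; lra.
- have : sup A <= (N 1 s - N 1 t) / (s - t) by apply: ge_sup => //; apply: ubA.
  by rewrite ler_pdivlMr ?subr_gt0 //; lra.
Qed.

(** * The norm near the vertices of the octagon *)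

(** On [[-2 W, 2 W]] the values of [N 1] lie between [1] and [1 + 2 k W]; the subgradient inequality
    at [t + W] and [t - W] then bounds [c]. *)
Lemma flat_subgradient (R : realType) (N : R -> R -> R) W k t c :
  min_pair N -> norm2 N -> 0 < W ->
  (forall s, `|s| <= 2 * W -> N 1 s <= 1 + k * `|s|) -> 0 <= k -> `|t| <= W ->
  (forall s, N 1 t + c * (s - t) <= N 1 s) -> `|c| <= 2 * k.
Proof.
move=> [h1 _ hb _] hN W0 hk k0 tW hc.
have hg s : 1 <= N 1 s by have := hb s; rewrite h1 mulr0 addr0 add0r mulr1.
have h s : `|s| <= 2 * W -> N 1 s <= 1 + 2 * k * W.
  move=> sW; apply: le_trans (hk _ sW) _; rewrite lerD2l (mulrC 2) -mulrA.
  exact: ler_wpM2l.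
have := hc (t + W); have := hc (t - W); have := hg t.
have : N 1 (t + W) <= 1 + 2 * k * W.
  by apply: h; apply: le_trans (ler_normD _ _) _; rewrite (gtr0_norm W0); lra.
have : N 1 (t - W) <= 1 + 2 * k * W.
  by apply: h; apply: le_trans (ler_normB _ _) _; rewrite (gtr0_norm W0); lra.
move=> f1 f2 f3 f4 f5; rewrite ler_norml.
rewrite -(ler_pM2r W0) -[X in _ && X](ler_pM2r W0).
by apply/andP; split; lra.
Qed.

Lemma flat_lipschitz (R : realType) (N : R -> R -> R) W k :
  min_pair N -> norm2 N -> 0 < W ->
  (forall s, `|s| <= 2 * W -> N 1 s <= 1 + k * `|s|) -> 0 <= k ->
  forall a b, `|a| <= W -> `|b| <= W -> N 1 a <= N 1 b + 2 * k * `|a - b|.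
Proof.
move=> hm hN W0 hk k0 a b aW bW.
have [c hc] := subgradient a hN.
have := flat_subgradient hm hN W0 hk k0 aW hc.
have := hc b => h hck.
have : c * (a - b) <= 2 * k * `|a - b|.
  by apply: le_trans (ler_norm _) _; rewrite normrM; apply: ler_wpM2r.
by move: h; rewrite -(opprB a b) mulrN; lra.
Qed.

(** The linear form [(n - t c) x + c y], with [n = N 1 t], equals [n] at [(1, t)] and is at most the
    norm on the half plane [x > 0]. The stated direction spans its kernel, and small multiples of it
    do not leave the half plane. *)
Lemma bj2_subgradient (R : realType) (N : R -> R -> R) t c :
  norm2 N -> (forall s, N 1 t + c * (s - t) <= N 1 s) ->
  bj2 N 1 t (- c) (N 1 t - t * c).
Proof.
move=> hN hc; set n := N 1 t.
have k0 : 0 < (2 * (`|c| + 1))^-1.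
  by rewrite invr_gt0; have := normr_ge0 c; lra.
apply: (bj2_local hN k0) => s hs.
have sc : s * c <= 2^-1.
  apply: le_trans (ler_norm _) _; rewrite normrM.
  apply: (@le_trans _ _ ((2 * (`|c| + 1))^-1 * (`|c| + 1))).
    by apply: ler_pM => //; rewrite lerDl.
  by rewrite invfM mulfVK // gt_eqF // ltr_wpDl.
have d0 : 0 < 1 + s * - c by lra.
have dn : 1 + s * - c != 0 by rewrite gt_eqF.
rewrite (_ : N (1 + s * - c) _ = (1 + s * - c) * N 1 (t + s * n / (1 + s * - c))).
  have := hc (t + s * n / (1 + s * - c)); rewrite -/n addrAC subrr add0r.
  rewrite -(ler_pM2l d0) mulrDr.
  by have -> : (1 + s * - c) * (c * (s * n / (1 + s * - c))) = c * s * n; [field|lra].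
rewrite -(norm2_posZ (c := 1 + s * - c) _ _ hN (ltW d0)).
by congr (N _ _); [rewrite mulr1|field].
Qed.

(** The squares differ by at most [2 m], and [x + y >= 2]. *)
Lemma sqr_near_le (R : realType) (x y z m : R) : 1 <= x -> 1 <= y ->
  `|x ^+ 2 - 1 - z ^+ 2| <= m -> `|y ^+ 2 - 1 - z ^+ 2| <= m -> x <= y + m.
Proof. by rewrite !ler_norml => hx hy /andP[? ?] /andP[? ?]; nra. Qed.

(* Rectangularity for p = (1, t) and the tangent vectors +-(-t', 1), t' = c / (n - t c),
   bounds the norms at these points by those at the two diagonals, which lie near
   slope t in the frames turned by 45 and 135 degrees; the terms depending on the
   displacement t' - t are absorbed thanks to the Lipschitz constant 1/12. *)
Lemma slope_estimate (R : realType) (N : R -> R -> R) W t c m :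
  let N1 := rot45 N in let N2 := rot45 N1 in let N3 := rot45 N2 in
  norm2 N -> rectangular N -> 0 < W <= 1 ->
  (forall M, M = N1 \/ M = N2 \/ M = N3 -> forall a b,
     `|a| <= W -> `|b| <= W -> M 1 a <= M 1 b + 1 / 12 * `|a - b|) ->
  `|t| <= W / 8 -> `|c| <= W / 8 ->
  (forall s, N 1 t + c * (s - t) <= N 1 s) ->
  (forall M, M = N \/ M = N1 \/ M = N2 \/ M = N3 ->
     1 <= M 1 t /\ `|M 1 t ^+ 2 - 1 - t ^+ 2| <= m) ->
  `|2 * N 1 t * c - 2 * t| <= 6 * m.
Proof.
move=> N1 N2 N3 hN hr /andP[W0 W1] hL tW cW hc hm.
have [n1 e0] := hm N (or_introl erefl).
have [g1 e1] : 1 <= N1 1 t /\ `|N1 1 t ^+ 2 - 1 - t ^+ 2| <= m by apply: hm; auto.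
have [g2 e2] : 1 <= N2 1 t /\ `|N2 1 t ^+ 2 - 1 - t ^+ 2| <= m by apply: hm; auto.
have [g3 e3] : 1 <= N3 1 t /\ `|N3 1 t ^+ 2 - 1 - t ^+ 2| <= m by apply: hm; auto 6.
have hb := bj2_subgradient hN hc.
set n := N 1 t in n1 e0 hb *.
have tc : `|t * c| <= 1 / 64.
  rewrite normrM; apply: (@le_trans _ _ (1 / 8 * (1 / 8))); last by lra.
  by apply: ler_pM => //; lra.
have d0 : 63 / 64 <= n - t * c by have := ler_norm (t * c); lra.
have dp : 0 < n - t * c by lra.
have dn : n - t * c != 0 by rewrite gt_eqF.
pose t' := c / (n - t * c).
have ct : c = t' * (n - t * c) by rewrite /t' divfK.
have t'W : `|t'| <= W / 7.
  rewrite /t' normrM normfV (gtr0_norm dp) ler_pdivrMr //.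
  apply: le_trans cW _; apply: (@le_trans _ _ (W / 7 * (63 / 64))); first by lra.
  by apply: ler_wpM2l => //; lra.
pose ep := t' - t.
have m0 : 0 <= m by apply: le_trans e0.
pose E := n ^+ 2 - 1 - t ^+ 2.
have tt' : `|t * t'| <= 1 / 56.
  rewrite normrM; apply: (@le_trans _ _ (1 / 8 * (1 / 7))); last by lra.
  by apply: ler_pM => //; lra.
have u0 : 55 / 56 <= 1 + t * t' by have := ler_norm (- (t * t')); rewrite normrN; lra.
(* For the Euclidean norm [ep] and [E] vanish. In general they control the error of the slope, and a
   bound [5 / 2 * m] on [ep] suffices because [2 (5/2 + 1/7) (56/55) < 6]. *)
have key : (n * c - t) * (1 + t * t') = ep + t' * E.
  have : c * (1 + t * t') = t' * n by lra.
  move=> h; rewrite mulrBl -[n * c * _]mulrA h /E /ep; ring.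
suff hep : `|ep| <= 5 / 2 * m.
  have hE : `|ep + t' * E| <= 5 / 2 * m + 1 / 7 * m.
    apply: le_trans (ler_normD _ _) _; apply: lerD => //.
    by rewrite normrM; apply: ler_pM => //; lra.
  have : `|n * c - t| * (55 / 56) <= 5 / 2 * m + 1 / 7 * m.
    apply: le_trans hE; rewrite -key normrM ler_wpM2l //.
    by apply: le_trans u0 _; exact: ler_norm.
  rewrite (_ : 2 * n * c - 2 * t = 2 * (n * c - t)); last by ring.
  by rewrite normrM (ger0_norm (_ : 0 <= 2)) //; lra.
have s10 := sqr_near_le g1 n1 e1 e0; have s12 := sqr_near_le g1 g2 e1 e2.
have s30 := sqr_near_le g3 n1 e3 e0; have s32 := sqr_near_le g3 g2 e3 e2.
clear e0 e1 e2 e3 E  key u0 tt' tc ct d0.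
have epW : `|ep| <= 2 / 7 * W by apply: le_trans (ler_normB _ _) _; lra.
have tb : `|t + t'| <= 2 / 7 * W by apply: le_trans (ler_normD _ _) _; lra.
have ep1 := ler_norm ep; have ep2 := ler_norm (- ep); rewrite normrN in ep2.
have tt1 := ler_norm t; have tt2 := ler_norm (- t); rewrite normrN in tt2.
have hq : bj2 N 1 t (- t') 1.
  have := bj2Z 1 (n - t * c)^-1 hN hb; rewrite !mul1r.
  have -> : (n - t * c)^-1 * - c = - t' by rewrite /t'; ring.
  by rewrite mulVf.
have w0 := invsqrt2_gt0 R; have ww := invsqrt2_sqr R.
have r0 := sqrt2_gt0 R; have rr := sqrt2_sqr R.
have rw : Num.sqrt 2 * (Num.sqrt 2)^-1 = 1 :> R by rewrite divff // gt_eqF.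
have N2E a : N2 1 a = N (- a) 1 by rewrite /N2 /N1 rot45_rot45.
have q1 := hr _ _ _ _ hq.
have q2 : n + N2 1 t' <= Num.sqrt 2 * N (1 + t') (t - 1).
  have := hr _ _ _ _ (bj2Z 1 (-1) hN hq); rewrite !mul1r !mulN1r opprK.
  by rewrite N2E -(norm2N (- t') 1 hN) opprK.
rewrite -/n -N2E in q1.
have l2 : N2 1 t <= N2 1 t' + 1 / 12 * `|ep|.
  by have := hL N2 (or_intror (or_introl erefl)) t t'; rewrite distrC; apply; lra.
have a1 : 0 < 2 - ep by lra.
have a2 : 0 < 2 + ep by lra.
have b1 : 2 - ep != 0 by rewrite gt_eqF.
have b2 : 2 + ep != 0 by rewrite gt_eqF.
have wE : (Num.sqrt 2)^-1 = Num.sqrt 2 / 2 :> R.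
  by apply: (mulfI (lt0r_neq0 r0)); rewrite rw mulrA rr divff // pnatr_eq0.
clear rw rr ww w0.
have k1 : (2 - ep) * ((t + t') / (2 - ep)) = t + t' by rewrite mulrC divfK.
have k2 : (2 + ep) * ((t + t') / (2 + ep)) = t + t' by rewrite mulrC divfK.
(* In the frames turned by 45 and 135 degrees, [sqrt 2] times the diagonals have first coordinates
   [2 - ep] and [2 + ep], and both have second coordinate [t + t']. *)
have i1 : Num.sqrt 2 * N (1 + - t') (t + 1) = (2 - ep) * N1 1 ((t + t') / (2 - ep)).
  rewrite -(norm2_posZ (c := Num.sqrt 2) _ _ hN (ltW r0)).
  rewrite -(norm2_posZ (c := 2 - ep) _ _ (norm2_rot45 hN) (ltW a1)).
  rewrite k1 mulr1 /N1 /rot45 /lin2 wE.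
  by congr (N _ _); rewrite /ep; field.
have i2 : Num.sqrt 2 * N (1 + t') (t - 1) = (2 + ep) * N3 1 ((t + t') / (2 + ep)).
  rewrite /N3 /N2 rot45_rot45 -(norm2_posZ (c := Num.sqrt 2) _ _ hN (ltW r0)).
  rewrite -(norm2_posZ (c := 2 + ep) _ _ (norm2_rot45 hN) (ltW a2)).
  rewrite mulrN k2 mulr1 /N1 /rot45 /lin2 wE -norm2N //.
  by congr (N _ _); rewrite /ep; field.
rewrite i1 in q1; rewrite i2 in q2; clear i1 i2 wE r0.
(* Replacing the slope [x] by [t] costs at most [1/12 * 9/8 = 3/32] times [|ep|]. *)
have jj M a x : M = N1 \/ M = N2 \/ M = N3 -> 12 / 7 <= a -> a * x = t + t' ->
    `|a * x - a * t| <= 9 / 8 * `|ep| -> a * M 1 x <= a * M 1 t + 3 / 32 * `|ep|.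
  move=> hM ha hx; have ap : 0 < a by lra.
  rewrite -mulrBr normrM (gtr0_norm ap) => h.
  have xW : `|x| <= W.
    rewrite -(ler_pM2l ap) -{1}(gtr0_norm ap) -normrM hx; apply: le_trans tb _.
    by apply: ler_wpM2r; lra.
  have tW' : `|t| <= W by lra.
  have := hL M hM x t xW tW'; rewrite -(ler_pM2l ap (M 1 x)) mulrDr.
  by move: h; move: (M 1 x) (M 1 t) => u v; lra.
have j1 : (2 - ep) * N1 1 ((t + t') / (2 - ep)) <= (2 - ep) * N1 1 t + 3 / 32 * `|ep|.
  apply: jj => //; [by auto|by lra|].
  rewrite k1 (_ : _ - _ = (1 + t) * ep); last by rewrite /ep; ring.
  rewrite normrM ler_wpM2r // ler_norml; lra.
have j2 : (2 + ep) * N3 1 ((t + t') / (2 + ep)) <= (2 + ep) * N3 1 t + 3 / 32 * `|ep|.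
  apply: jj => //; [by auto|by lra|].
  rewrite k2 (_ : _ - _ = (1 - t) * ep); last by rewrite /ep; ring.
  rewrite normrM ler_wpM2r // ler_norml; lra.
clear tb k1 k2 jj tt1 tt2 epW t'W tW cW.
(* The sign of [ep] selects the diagonal whose first coordinate is at most [2]. Its gain of at least
   [|ep|] outweighs the losses [3/32 |ep|] and [1/12 |ep|], which leaves [79/96 |ep| <= 2 m]. *)
have [p0|p0] := lerP 0 ep.
  rewrite (ger0_norm p0) in l2 j1 *.
  have : ep <= ep * N1 1 t by rewrite ler_peMr.
  by lra.
rewrite (ltr0_norm p0) in l2 j2 *.
have : - ep <= - ep * N3 1 t by rewrite ler_peMr //; lra.
by lra.
Qed.

(** Over [n] equal steps from [0] to [t] the quadratic terms add up to [t ^+ 2 / n], which is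
    arbitrarily small. *)
Lemma quadratic_lipschitz (R : realType) (f : R -> R) T K :
  0 <= K -> f 0 = 0 ->
  (forall a b, `|a| <= T -> `|b| <= T -> `|f b - f a| <= K * `|b - a| + (b - a) ^+ 2) ->
  forall t, `|t| <= T -> `|f t| <= K * `|t|.
Proof.
move=> K0 f0 hf t tT; apply/ler_addgt0Pr => e e0.
pose n := (Num.trunc (t ^+ 2 / e)).+1.
have n0 : 0 < n%:R :> R by rewrite ltr0n.
have hn : t ^+ 2 / n%:R <= e.
  rewrite ler_pdivrMr // mulrC -ler_pdivrMr //; apply: ltW.
  by apply: truncnS_gt.
suff h j : (j <= n)%N -> `|f (j%:R * (t / n%:R))| <=
    j%:R * (K * (`|t| / n%:R) + (t / n%:R) ^+ 2).
  have := h n (leqnn n); rewrite [n%:R * (t / _)]mulrC divfK ?gt_eqF // => /le_trans; apply.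
  rewrite mulrDr mulrCA [n%:R * (_ / _)]mulrC divfK ?gt_eqF // lerD2l.
  have -> // : n%:R * (t / n%:R) ^+ 2 = t ^+ 2 / n%:R.
  by field; rewrite gt_eqF.
have small i : (i <= n)%N -> `|i%:R * (t / n%:R)| <= T.
  move=> i_n; apply: le_trans tT; rewrite !normrM normfV !normr_nat mulrCA.
  by rewrite ler_piMr // ler_pdivrMr // mul1r ler_nat.
elim: j => [_|j IH jn]; first by rewrite !mul0r f0 normr0.
have h1 := IH (ltnW jn).
have := hf _ _ (small j (ltnW jn)) (small _ jn).
rewrite -mulrBl -natrB // subSnn mul1r normrM normfV normr_nat => h2.
rewrite -[X in _ <= X * _]natr1 [X in _ <= X]mulrDl mul1r.
have := ler_normD (f (j%:R * (t / n%:R))) (f (j.+1%:R * (t / n%:R)) - f (j%:R * (t / n%:R))).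
by rewrite addrCA subrr addr0; lra.
Qed.

Lemma geometric_zero (R : realType) (x : R) :
  (forall n, `|x| <= (2 ^+ n)^-1) -> x = 0.
Proof.
move=> h; apply/eqP; rewrite -normr_eq0 -[_ == 0]negbK; apply/negP => x0.
have xp : 0 < `|x| by rewrite lt_neqAle eq_sym x0 normr_ge0.
pose n := (Num.trunc `|x|^-1).+1.
have := h n; apply/negP; rewrite -ltNge invf_plt ?posrE ?exprn_gt0 //.
apply: lt_trans (truncnS_gt _) _; rewrite -natrX ltr_nat.
exact: ltn_expl.
Qed.

Lemma rot45_period (R : realType) (N : R -> R -> R) k :
  norm2 N -> iter k.+4 (@rot45 R) N = iter k (@rot45 R) N.
Proof.
move=> hN; rewrite !iterS; apply/funext => a; apply/funext => b; apply: rot45_4.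
by elim: k => //= k; exact: norm2_rot45.
Qed.

Lemma min_pair_iter (R : realType) (N : R -> R -> R) k :
  norm2 N -> rectangular N -> min_pair N ->
  [/\ norm2 (iter k (@rot45 R) N), rectangular (iter k (@rot45 R) N) &
      min_pair (iter k (@rot45 R) N)].
Proof.
move=> hN hr hm; elim: k => //= k [h1 h2 h3]; split.
- exact: norm2_rot45.
- exact: rectangular_rot45.
- exact: min_pair_rot45.
Qed.

(** The frames repeat with period four, so the least of four radii serves for every [k]. *)
Lemma min_pair_flat_iter (R : realType) (N : R -> R -> R) r :
  norm2 N -> rectangular N -> min_pair N -> 0 < r ->
  exists2 e : R, 0 < e & forall k t, `|t| <= e -> iter k (@rot45 R) N 1 t <= 1 + r * `|t|.
Proof.
move=> hN hr hm r0.
have h k : exists2 e : R, 0 < e &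
    forall t, `|t| <= e -> iter k (@rot45 R) N 1 t <= 1 + r * `|t|.
  by have [? ? ?] := min_pair_iter k hN hr hm; exact: min_pair_flat.
have [[e0 p0 h0] [e1 p1 h1]] := (h 0, h 1).
have [[e2 p2 h2] [e3 p3 h3]] := (h 2, h 3).
exists (Num.min (Num.min e0 e1) (Num.min e2 e3)); first by rewrite !lt_min p0 p1 p2.
pose P k := forall t, `|t| <= Num.min (Num.min e0 e1) (Num.min e2 e3) ->
  iter k (@rot45 R) N 1 t <= 1 + r * `|t|.
suff H k : [/\ P k, P k.+1, P k.+2 & P k.+3] by move=> k; have [] := H k.
elim: k => [|k [q0 q1 q2 q3]].
  by split=> t; rewrite !le_min => /andP[/andP[? ?] /andP[? ?]]; auto.
by split=> //; rewrite /P rot45_period.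
Qed.

(** The Gronwall argument: if the deviation of the squared norm is at most [m] in all frames, its
    slope is at most [6 m], and integrating over a length of at most [T <= 1/12] gives [m / 2].
    Iteration yields [2^-n] for every [n]. *)
Lemma min_pair_local (R : realType) (N : R -> R -> R) :
  norm2 N -> rectangular N -> min_pair N ->
  exists2 e : R, 0 < e &
    forall k t, `|t| <= e -> iter k (@rot45 R) N 1 t ^+ 2 = 1 + t ^+ 2.
Proof.
move=> hN hr hm.
pose M k := iter k (@rot45 R) N.
have hM k : [/\ norm2 (M k), rectangular (M k) & min_pair (M k)] by exact: min_pair_iter.
(* The constant [1/24] doubles to the Lipschitz constant [1/12] that the slope estimate requires. *)
have [e1 p1 h1] : exists2 e : R, 0 < e & forall k t, `|t| <= e -> M k 1 t <= 1 + 1 / 24 * `|t|.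
  by apply: min_pair_flat_iter => //; lra.
pose W := Num.min (e1 / 2) 1.
have W0 : 0 < W by rewrite lt_min; apply/andP; split; lra.
have W1 : W <= 1 by rewrite ge_min lexx orbT.
have We : 2 * W <= e1 by have : W <= e1 / 2; [by rewrite ge_min lexx|lra].
(* The constant [W / 16] doubles to the bound [W / 8] on subgradients that the slope estimate
   requires. *)
have [e2 p2 h2] : exists2 e : R, 0 < e & forall k t, `|t| <= e -> M k 1 t <= 1 + W / 16 * `|t|.
  by apply: min_pair_flat_iter => //; lra.
pose T := Num.min (Num.min (e2 / 2) (W / 8)) (1 / 12).
have T0 : 0 < T by rewrite !lt_min; apply/andP; split; [apply/andP; split|]; lra.
have [Te TW T12] : [/\ 2 * T <= e2, T <= W / 8 & T <= 1 / 12].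
  have : T <= e2 / 2 by rewrite !ge_min lexx.
  by split; [lra|rewrite !ge_min lexx orbT|rewrite !ge_min lexx orbT].
have ge1 k t : 1 <= M k 1 t.
  have [_ _ [a1 _ hb _]] := hM k.
  by have := hb t; rewrite a1 mulr0 addr0 add0r mulr1.
have hL k a b : `|a| <= W -> `|b| <= W -> M k 1 a <= M k 1 b + 1 / 12 * `|a - b|.
  move=> aW bW; have [n1 _ n3] := hM k.
  rewrite (_ : 1 / 12 = 2 * (1 / 24)); last by lra.
  apply: (flat_lipschitz n3 n1 W0) => //; last by lra.
  by move=> s sW; apply: h1; lra.
exists T => // k t tT.
suff H n : forall k t, `|t| <= T -> `|M k 1 t ^+ 2 - 1 - t ^+ 2| <= (2 ^+ n)^-1.
  have : M k 1 t ^+ 2 - 1 - t ^+ 2 = 0 by apply: geometric_zero => n; exact: H.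
  by rewrite -/(M k); lra.
clear k t tT; elim: n => [|n IH] k t tT.
  have := h1 k t; have := ge1 k t; rewrite expr0 invr1 => g1 g2.
  have := g2 ltac:(lra); have := normr_ge0 t; rewrite -(real_normK (num_real t)).
  rewrite ler_norml => t0 g3.
  by apply/andP; split; nra.
set m := (2 ^+ n)^-1 in IH.
have m0 : 0 < m by rewrite invr_gt0 exprn_gt0.
have slope j u c : `|u| <= T -> (forall s, M j 1 u + c * (s - u) <= M j 1 s) ->
    `|2 * M j 1 u * c - 2 * u| <= 6 * m.
  move=> uT hc; have [n1 n2 n3] := hM j.
  apply: (@slope_estimate _ (M j) W) => //.
  - by rewrite W0.
  - move=> _ [->|[->|->]] a b aW bW;
      [exact: (hL j.+1)|exact: (hL j.+2)|exact: (hL j.+3)].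
  - by lra.
  - rewrite (_ : W / 8 = 2 * (W / 16)); last by lra.
    apply: (flat_subgradient n3 n1 T0 _ _ uT hc); last by lra.
    by move=> s sT; apply: h2; lra.
  - move=> _ [->|[->|[->|->]]]; split;
      [exact: ge1|exact: IH|exact: (ge1 j.+1)|exact: (IH j.+1)|
       exact: (ge1 j.+2)|exact: (IH j.+2)|exact: (ge1 j.+3)|exact: (IH j.+3)].
pose f u := M k 1 u ^+ 2 - 1 - u ^+ 2.
(* A subgradient bounds increments of [f] only from below; exchanging [a] and [b] supplies the upper
   bound, so differentiability never enters. *)
have low a b : `|a| <= T -> - (6 * m * `|b - a| + (b - a) ^+ 2) <= f b - f a.
  move=> aT; have [n1 _ _] := hM k; have [c hc] := subgradient a n1.
  have h := slope k a c aT hc.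
  have : `|(2 * M k 1 a * c - 2 * a) * (b - a)| <= 6 * m * `|b - a|.
    by rewrite normrM ler_wpM2r.
  rewrite ler_norml => /andP[h3 _]; rewrite /f.
  have := hc b; have := ge1 k a; move: (M k 1 a) (M k 1 b) h3 => x y h3 x1 h4.
  have : 0 <= x * (y - (x + c * (b - a))) by apply: mulr_ge0; lra.
  have := sqr_ge0 (y - x); lra.
have : `|f t| <= 6 * m * `|t|.
  apply: (@quadratic_lipschitz _ f T) => //; first by lra.
    by have [_ _ [a1 _ _ _]] := hM k; rewrite /f a1; ring.
  move=> a b aT bT; rewrite ler_norml low //=.
  have := low b a bT; rewrite distrC.
  by rewrite (_ : (a - b) ^+ 2 = (b - a) ^+ 2); [lra|ring].
move/le_trans; apply; rewrite exprS invfM -/m.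
have := normr_ge0 t; nra.
Qed.

(** * Propagation along the circle *)

(** The radius may be negative, so the compact range [[0, pi]] of angles covers all directions. *)
Lemma polar (R : realType) (a b : R) :
  exists r t, [/\ 0 <= t <= pi, a = r * cos t & b = r * sin t].
Proof.
wlog b0 : a b / 0 <= b.
  move=> h; have [/h //|b0] := lerP 0 b.
  have [r [t [t0 e1 e2]]] := h (- a) (- b) ltac:(lra).
  by exists (- r), t; split=> //; rewrite mulNr -?e1 -?e2 opprK.
have [ab|ab] := eqVneq (a ^+ 2 + b ^+ 2) 0.
  exists 0, 0; rewrite lexx pi_ge0 !mul0r.
  by split=> //; apply/eqP; rewrite -sqrf_eq0; apply/eqP;
    have := sqr_ge0 a; have := sqr_ge0 b; lra.
pose r := Num.sqrt (a ^+ 2 + b ^+ 2).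
have p0 : 0 < a ^+ 2 + b ^+ 2 by rewrite lt_neqAle eq_sym ab addr_ge0 ?sqr_ge0.
have r0 : 0 < r by rewrite sqrtr_gt0.
have rn : r != 0 by rewrite gt_eqF.
have r2 : r ^+ 2 = a ^+ 2 + b ^+ 2 by rewrite sqr_sqrtr // ltW.
have ar : -1 <= a / r <= 1.
  by rewrite ler_pdivlMr // ler_pdivrMr //; apply/andP; split; nra.
exists r, (acos (a / r)); split.
- by rewrite acos_ge0 // acos_lepi.
- by rewrite acosK ?in_itv //= mulrC divfK.
- rewrite sin_acos // -{1}(gtr0_norm r0) -sqrtr_sqr -sqrtrM ?sqr_ge0 //.
  rewrite (_ : r ^+ 2 * _ = b ^+ 2); first by rewrite sqrtr_sqr ger0_norm.
  by rewrite mulrBr mulr1 exprMn exprVn mulrCA divff ?expf_neq0 // mulr1 r2; ring.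
Qed.

Definition rot2 (R : realType) (x : R) (N : R -> R -> R) : R -> R -> R :=
  lin2 N (cos x) (- sin x) (sin x) (cos x).

Lemma rot2_det (R : realType) (x : R) : cos x * cos x - - sin x * sin x = 1.
Proof. by rewrite -(cos2Dsin2 x); ring. Qed.

Lemma norm2_rot2 (R : realType) (N : R -> R -> R) x : norm2 N -> norm2 (rot2 x N).
Proof. by apply: norm2_lin2; rewrite rot2_det oner_eq0. Qed.

Lemma rot2D (R : realType) (N : R -> R -> R) x y :
  rot2 x (rot2 y N) = rot2 (y + x) N.
Proof.
apply/funext => a; apply/funext => b; rewrite /rot2 /lin2 cosD sinD.
by congr (N _ _); ring.
Qed.

(** Rotations preserve areas, so minimality is inherited; the conditions that remain are closed in
    [x]. *)
Lemma min_pair_rot2 (R : realType) (N : R -> R -> R) x :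
  min_pair N ->
  min_pair (rot2 x N) <->
  [/\ N (cos x) (sin x) = 1, N (- sin x) (cos x) = 1 &
      bj2 N (cos x) (sin x) (- sin x) (cos x)].
Proof.
move=> hm; split=> [[]|[h1 h2 h3]]; last first.
  by apply: min_pair_lin2 => //; rewrite rot2_det normr1.
rewrite /rot2 {1 2}/lin2 !mulr0 !mulr1 !addr0 !add0r => h1 h2.
by move=> /bj2_lin2; rewrite !mulr0 !mulr1 !addr0 !add0r.
Qed.

Lemma euclidean_sector (R : realType) (N : R -> R -> R) e x y :
  norm2 N -> (forall t, `|t| <= e -> N 1 t ^+ 2 = 1 + t ^+ 2) ->
  0 < x -> `|y| <= e * x -> N x y ^+ 2 = x ^+ 2 + y ^+ 2.
Proof.
move=> hN h x0 yx; have xn : x != 0 by rewrite gt_eqF.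
rewrite -{1}(mulr1 x) -{1}(divfK xn y) (mulrC _ x) (norm2_posZ _ _ hN (ltW x0)).
rewrite exprMn h; last by rewrite normrM normfV (gtr0_norm x0) ler_pdivrMr.
by field.
Qed.

(** For small angles both rotated vectors, and the points near the first one on its tangent, lie in
    sectors where the norm is Euclidean. *)
Lemma min_pair_rot2_small (R : realType) (N : R -> R -> R) :
  norm2 N -> rectangular N -> min_pair N ->
  \forall x \near 0, min_pair (rot2 x N).
Proof.
move=> hN hr hm; have [e' e'0 he'] := min_pair_local hN hr hm.
pose e := Num.min e' 1.
have e0 : 0 < e by rewrite lt_min e'0 ltr01.
have e1 : e <= 1 by rewrite ge_min lexx orbT.
have he k t : `|t| <= e -> iter k (@rot45 R) N 1 t ^+ 2 = 1 + t ^+ 2.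
  by move=> te; apply: he'; apply: le_trans te _; rewrite ge_min lexx.
have sec := euclidean_sector hN (he 0).
(* The second vector [(- sin x, cos x)] is [(cos x, sin x)] in the frame of the quarter turn. *)
have sec2 := euclidean_sector (norm2_rot45 (norm2_rot45 hN)) (he 2).
have root1 y : 0 <= y -> y ^+ 2 = 1 -> y = 1.
  by move=> y0 y1; apply/eqP; rewrite -(@eqrXn2 _ 2) // y1 expr1n.
have ccos : cos x @[x --> (0 : R)] --> (1 : R).
  by have := @continuous_cos R 0; rewrite /continuous_at cos0.
have csin : sin x @[x --> (0 : R)] --> (0 : R).
  by have := @continuous_sin R 0; rewrite /continuous_at sin0.
near=> x.
have cx : 1 / 2 <= cos x.
  near: x; move/cvgrPdist_le : ccos => /(_ (1 / 2)) /(_ ltac:(lra)).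
  by apply: filterS => x; rewrite ler_norml => /andP[_]; lra.
have sx : `|sin x| <= e / 8.
  near: x; move/cvgrPdist_le : csin => /(_ (e / 8)) /(_ ltac:(lra)).
  by apply: filterS => x; rewrite sub0r normrN.
have cs := cos2Dsin2 x.
have c0 : 0 < cos x by lra.
have sc : `|sin x| <= e * cos x by apply: le_trans sx _; nra.
have h1 : N (cos x) (sin x) = 1.
  by apply: root1; [exact: norm2_ge0|rewrite sec].
apply/min_pair_rot2 => //; split=> //.
  by have := sec2 _ _ c0 sc; rewrite rot45_rot45 cs; apply: root1; exact: norm2_ge0.
have e8 : 0 < e / 8 by lra.
(* For [|s| <= e / 8] the tangent point has first coordinate at least [1 / 4] and second coordinate
   at most [e / 4] in absolute value, hence stays in the sector. *)
apply: (bj2_local hN e8) => s hs.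
have ss : `|s * sin x| <= 1 / 64.
  by rewrite normrM (_ : 1 / 64 = 1 / 8 * (1 / 8)); [apply: ler_pM => //; lra|lra].
have := ler_norm (s * sin x) => ss1.
have sc1 : `|s * cos x| <= e / 8.
  rewrite normrM -[leRHS]mulr1; apply: ler_pM => //.
  by rewrite (gtr0_norm c0) cos_le1.
rewrite h1 -(@ler_pXn2r _ 2) ?nnegrE ?norm2_ge0 // expr1n sec.
- have -> : (cos x + s * - sin x) ^+ 2 + (sin x + s * cos x) ^+ 2 =
    (1 + s ^+ 2) * (cos x ^+ 2 + sin x ^+ 2) by ring.
  by rewrite cs mulr1 lerDl sqr_ge0.
- by lra.
- apply: (@le_trans _ _ (e * (1 / 4))).
    by apply: le_trans (ler_normD _ _) _; lra.
  by apply: ler_wpM2l; lra.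
Unshelve. all: by end_near. Qed.

Lemma min_pair_rot2_all (R : realType) (N : R -> R -> R) x :
  norm2 N -> rectangular N -> min_pair N -> min_pair (rot2 x N).
Proof.
move=> hN hr hm; pose A := [set x : R | min_pair (rot2 x N)].
suff AT : A = setT by have : [set: R] x by []; rewrite -AT.
have cT : connected [set: R] by apply/connected_intervalP.
have cN (f g : R -> R) : continuous f -> continuous g ->
    continuous (fun y => N (f y) (g y)).
  by move=> cf cg y; apply: norm2_cvg; [exact: hN|exact: cf|exact: cg].
have cc := @continuous_cos R; have cs := @continuous_sin R.
have cNs : continuous (fun y : R => - sin y) by move=> y; apply: cvgN; exact: cs.
apply: cT.
- exists 0; rewrite /A /= (_ : rot2 0 N = N) //.
  apply/funext => a; apply/funext => b; rewrite /rot2 /lin2 cos0 sin0.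
  by congr (N _ _); ring.
(* Openness at [y] is the case of small angles for the norm [rot2 y N]. *)
- exists A; rewrite ?setTI // openE => y Ay.
  have hNy := norm2_rot2 y hN.
  have hry : rectangular (rot2 y N) by exact: rectangular_lin2.
  have := min_pair_rot2_small hNy hry Ay.
  move=> h.
  have : \forall z \near y, min_pair (rot2 (z - y) (rot2 y N)).
    have zy : (z - y) @[z --> y] --> (0 : R).
      by rewrite -(subrr y); apply: cvgB; [exact: cvg_id|exact: cvg_cst].
    exact: zy h.
  by apply: filterS => z; rewrite rot2D subrKC.
- exists A; rewrite ?setTI //.
  have -> : A = [set y | N (cos y) (sin y) = 1] `&` [set y | N (- sin y) (cos y) = 1]
     `&` \bigcap_(s in [set: R])
       [set y | N (cos y) (sin y) <= N (cos y + s * - sin y) (sin y + s * cos y)].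
    apply/seteqP; split=> y.
      move=> /(min_pair_rot2 _ hm) [h1 h2 h3]; split; first by split.
      by move=> s _; exact: h3.
    move=> [[h1 h2] h3]; apply/(min_pair_rot2 _ hm); split=> // s.
    exact: h3.
  apply: closedI; [apply: closedI|apply: closed_bigI => s _].
  - apply: (preimage_closed (f := fun y : R => N (cos y) (sin y)) (D := [set z | z = 1])).
      by move=> z _; exact: cN.
    exact: closed_eq.
  - apply: (preimage_closed (f := fun y : R => N (- sin y) (cos y)) (D := [set z | z = 1])).
      by move=> z _; exact: cN.
    exact: closed_eq.
  - rewrite (_ : mkset _ = (fun y : R => N (cos y + s * - sin y) (sin y + s * cos y)
        - N (cos y) (sin y)) @^-1` [set z | 0 <= z]); last first.
      by apply/seteqP; split=> y /=; rewrite subr_ge0.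
    apply: preimage_closed; last exact: closed_ge.
    have c1 : continuous (fun y => N (cos y + s * - sin y) (sin y + s * cos y)).
      apply: cN => z; apply: cvgD; [exact: cc| |exact: cs|].
        by apply: cvgM; [exact: cvg_cst|exact: cNs].
      by apply: cvgM; [exact: cvg_cst|exact: cc].
    have c2 : continuous (fun y => N (cos y) (sin y)) by exact: cN.
    by move=> y _; exact: cvgB (c1 y) (c2 y).
Qed.

Lemma min_pair_euclidean (R : realType) (N : R -> R -> R) a b :
  norm2 N -> rectangular N -> min_pair N -> N a b ^+ 2 = a ^+ 2 + b ^+ 2.
Proof.
move=> hN hr hm; have [r [t [_ -> ->]]] := polar a b.
have /(min_pair_rot2 _ hm) [h _ _] := min_pair_rot2_all t hN hr hm.
case: hN => hZ _ _; rewrite hZ h mulr1 real_normK ?num_real //.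
by rewrite -[LHS]mulr1 -(cos2Dsin2 t); ring.
Qed.

(** * Existence of a minimal pair *)

(** The angles of orthogonal pairs of directions form a compact set, on which the area spanned by
    the normalised vectors attains its minimum. The minimisers, scaled to norm [1], are the new
    basis. *)
Lemma min_pair_exists (R : realType) (N : R -> R -> R) : norm2 N ->
  exists p q r s, p * s - q * r != 0 /\ min_pair (lin2 N p q r s).
Proof.
move=> hN; case: (hN) => hZ _ _.
have n0 x : 0 < N (cos x) (sin x).
  apply: norm2_gt0 => //; rewrite -negb_and; apply/negP => /andP[/eqP c0 /eqP s0].
  by have := cos2Dsin2 x; rewrite c0 s0 expr0n addr0 => /eqP; rewrite eq_sym oner_eq0.
pose K := (`[0, pi] `*` `[0, pi])
  `&` [set x : R * R | bj2 N (cos x.1) (sin x.1) (cos x.2) (sin x.2)].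
have cosf : continuous (fun x : R * R => cos x.1).
  by move=> x; apply: continuous_comp; [exact: cvg_fst|exact: continuous_cos].
have sinf : continuous (fun x : R * R => sin x.1).
  by move=> x; apply: continuous_comp; [exact: cvg_fst|exact: continuous_sin].
have coss : continuous (fun x : R * R => cos x.2).
  by move=> x; apply: continuous_comp; [exact: cvg_snd|exact: continuous_cos].
have sins : continuous (fun x : R * R => sin x.2).
  by move=> x; apply: continuous_comp; [exact: cvg_snd|exact: continuous_sin].
have cN (f g : R * R -> R) : continuous f -> continuous g ->
    continuous (fun y => N (f y) (g y)).
  by move=> cf cg y; apply: norm2_cvg; [exact: hN|exact: cf|exact: cg].
have cK : compact K.
  apply: compact_closedI; first by apply: compact_setX; exact: segment_compact.
  rewrite (_ : mkset _ = \bigcap_(s in [set: R])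
    ((fun x => N (cos x.1 + s * cos x.2) (sin x.1 + s * sin x.2) - N (cos x.1) (sin x.1))
       @^-1` [set z | 0 <= z])); last first.
    apply/seteqP; split=> x h s; first by move=> _; rewrite /= subr_ge0; exact: h.
    by rewrite -subr_ge0; exact: h.
  apply: closed_bigI => s _; apply: preimage_closed; last exact: closed_ge.
  have c1 : continuous (fun x => N (cos x.1 + s * cos x.2) (sin x.1 + s * sin x.2)).
    apply: cN => z; apply: cvgD; [exact: cosf| |exact: sinf|].
      by apply: cvgM; [exact: cvg_cst|exact: coss].
    by apply: cvgM; [exact: cvg_cst|exact: sins].
  have c2 : continuous (fun x : R * R => N (cos x.1) (sin x.1)) by exact: cN.
  by move=> x _; exact: cvgB (c1 x) (c2 x).
have K0 : K !=set0.
  have [t ht] := bj2_exists 0 1 1 0 hN.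
  have [r [x [x0 e1 e2]]] := polar (0 + t * 1) (1 + t * 0).
  have r0 : r != 0.
    by apply/eqP => r0; move: e2; rewrite r0; lra.
  exists (x, 0); split; first by split; rewrite /= in_itv /= ?lexx ?pi_ge0.
  have := bj2Z r^-1 1 hN ht.
  by rewrite e1 e2 !mulKf // mulr1 mulr0 /= cos0 sin0.
pose F (x : R * R) := `|cos x.1 * sin x.2 - sin x.1 * cos x.2| /
  (N (cos x.1) (sin x.1) * N (cos x.2) (sin x.2)).
have cF : continuous F.
  move=> x; apply: cvgM.
    by apply: cvg_norm; apply: cvgB; apply: cvgM;
      [exact: cosf|exact: sins|exact: sinf|exact: coss].
  apply: cvgV; first by rewrite mulf_neq0 // gt_eqF.
  by apply: cvgM; apply: norm2_cvg => //;
    [exact: cosf|exact: sinf|exact: coss|exact: sins].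
have [[x y] xyK hmin] := compact_EVT_min K0 cK (continuous_subspaceT cF).
move: xyK; rewrite inE => -[_ /= hxy].
set n1 := N (cos x) (sin x); set n2 := N (cos y) (sin y).
have [n1p n2p] : 0 < n1 /\ 0 < n2 by split; exact: n0.
have [n1n n2n] : n1 != 0 /\ n2 != 0 by rewrite !gt_eqF.
pose d := cos x * sin y - sin x * cos y.
(* If [d = 0], subtracting from the first direction its Euclidean projection to the second leaves
   zero, which contradicts orthogonality since the first direction has positive norm. *)
have dn : d != 0.
  apply/eqP => d0; pose l := - (cos x * cos y + sin x * sin y); have := hxy l.
  have cs := cos2Dsin2 y.
  have -> : cos x + l * cos y = cos x * (1 - (cos y ^+ 2 + sin y ^+ 2)) + d * sin y.
    by rewrite /l /d; ring.
  have -> : sin x + l * sin y = sin x * (1 - (cos y ^+ 2 + sin y ^+ 2)) - d * cos y.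
    by rewrite /l /d; ring.
  by rewrite cs d0 subrr !mulr0 !mul0r addr0 subr0 norm2_00 // leNgt n0.
pose D := `|d| / (n1 * n2).
have Dp : 0 < D by rewrite divr_gt0 ?normr_gt0 ?mulr_gt0.
exists (cos x / n1), (cos y / n2), (sin x / n1), (sin y / n2).
have detE : cos x / n1 * (sin y / n2) - cos y / n2 * (sin x / n1) = d / (n1 * n2).
  by rewrite /d; field; rewrite n1n n2n.
split; first by rewrite detE mulf_neq0 // invr_eq0 mulf_neq0.
split.
- rewrite /lin2 !mulr1 !mulr0 !addr0 ![_ / n1]mulrC hZ gtr0_norm ?invr_gt0 //.
  by rewrite mulVf.
- rewrite /lin2 !mulr1 !mulr0 !add0r ![_ / n2]mulrC hZ gtr0_norm ?invr_gt0 //.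
  by rewrite mulVf.
- apply/bj2_lin2; rewrite !mulr1 !mulr0 !addr0 !add0r.
  by rewrite ![_ / n1]mulrC ![_ / n2]mulrC; exact: bj2Z.
move=> a b a' b' /bj2_lin2; rewrite /lin2.
(* The change of coordinates multiplies areas by [d / (n1 * n2)], whose absolute value [D] is the
   minimum of [F]; this turns [hmin] into the minimality clause. *)
have : (cos x / n1 * a + cos y / n2 * b) * (sin x / n1 * a' + sin y / n2 * b') -
  (sin x / n1 * a + sin y / n2 * b) * (cos x / n1 * a' + cos y / n2 * b') =
  d / (n1 * n2) * (a * b' - b * a') by rewrite -detE; ring.
move: (cos x / n1 * a + _) (sin x / n1 * a + _) (cos x / n1 * a' + _)
  (sin x / n1 * a' + _) => u v u' v'.
have [r [t [t0 -> ->]]] := polar u v; have [r' [t' [t'0 -> ->]]] := polar u' v'.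
move=> hdet hb; rewrite !hZ.
have [->|rn] := eqVneq r 0; first by rewrite normr0 !mul0r.
have [->|r'n] := eqVneq r' 0; first by rewrite normr0 mul0r mulr0.
have : F (x, y) <= F (t, t').
  apply: hmin; rewrite inE; split; first by split; rewrite /= in_itv.
  by have := bj2Z r^-1 r'^-1 hN hb; rewrite !mulKf.
rewrite /F /= -/n1 -/n2 -/d -/D ler_pdivlMr ?mulr_gt0 // => h.
rewrite -(ler_pM2l Dp).
have -> : D * `|a * b' - b * a'| =
    `|r| * `|r'| * `|cos t * sin t' - sin t * cos t'|.
  rewrite /D -(gtr0_norm (_ : 0 < n1 * n2)) ?mulr_gt0 // -normfV -!normrM -hdet.
  by congr (`|_|); ring.
rewrite (_ : D * _ = `|r| * `|r'| * (D * (N (cos t) (sin t) * N (cos t') (sin t'))));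
  last by ring.
by rewrite ler_wpM2l ?mulr_ge0.
Qed.

(** In the basis of a minimal pair the squared norm is the standard form; the coefficients come from
    the inverse of the change of basis. *)
Lemma rectangular_quadratic (R : realType) (N : R -> R -> R) :
  norm2 N -> rectangular N ->
  exists A B C, forall a b, N a b ^+ 2 = A * a ^+ 2 + B * (a * b) + C * b ^+ 2.
Proof.
move=> hN hr; have [p [q [r [s [dt hm]]]]] := min_pair_exists hN.
have hr' : rectangular (lin2 N p q r s) by exact: rectangular_lin2.
have hE a b := min_pair_euclidean a b (norm2_lin2 dt hN) hr' hm.
pose d := p * s - q * r.
exists ((s ^+ 2 + r ^+ 2) / d ^+ 2), (- 2 * (q * s + p * r) / d ^+ 2),
  ((q ^+ 2 + p ^+ 2) / d ^+ 2) => a b.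
have := hE ((s * a - q * b) / d) ((p * b - r * a) / d); rewrite /lin2.
have -> : p * ((s * a - q * b) / d) + q * ((p * b - r * a) / d) = a.
  by rewrite /d; field.
have -> : r * ((s * a - q * b) / d) + s * ((p * b - r * a) / d) = b.
  by rewrite /d; field.
by move=> ->; rewrite /d; field.
Qed.

(** * Reduction to planes *)

(** Scaling to unit vectors gives the hypothesis with [l] the ratio of the norms; the remaining
    ratios are settled by elementary bounds. *)
Lemma vector_rectangle (R : realType) (V : normedModType R) :
  (forall x y : V, unit_sphere V x -> unit_sphere V y ->
     birkhoff_james_orthogonal x y ->
     forall l : R, 3 - 2 * Num.sqrt 2 < `|l| < Num.sqrt 2 + 1 ->
       (1 + `|l|) / `|y + l *: x| <= Num.sqrt 2) ->
  forall x y : V, birkhoff_james_orthogonal x y ->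
    `|x| + `|y| <= Num.sqrt 2 * `|x + y|.
Proof.
move=> h x y hxy; have r0 := sqrt2_gt0 R; have rr := sqrt2_sqr R.
have r1 : 1 <= Num.sqrt 2 :> R by nra.
have [->|x0] := eqVneq x 0; first by rewrite normr0 !add0r ler_peMl.
have [->|y0] := eqVneq y 0; first by rewrite normr0 !addr0 ler_peMl.
have nx : 0 < `|x| by rewrite normr_gt0.
have ny : 0 < `|y| by rewrite normr_gt0.
have hx : `|x| <= `|x + y| by have := hxy 1; rewrite scale1r.
have hy : `|y| - `|x| <= `|x + y|.
  by have := lerB_dist y (- x); rewrite normrN opprK addrC [y + x]addrC.
pose l := `|x| / `|y|.
have l0 : 0 < l by rewrite divr_gt0.
have lx : l * `|y| = `|x| by rewrite /l divfK ?gt_eqF.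
(* The ends of the range are the exact thresholds of the two bounds: [1 + l <= sqrt 2 * l] for
   [l >= sqrt 2 + 1], used with [hx], and [1 + l <= sqrt 2 * (1 - l)] for [l <= 3 - 2 sqrt 2], used
   with [hy]. *)
have [l1|l1] := lerP (Num.sqrt 2 + 1) l.
  have : (Num.sqrt 2 + 1) * `|y| <= `|x| by rewrite -lx ler_pM2r.
  by clear -hx r0 rr r1 ny nx => *; nra.
have [l2|l2] := lerP l (3 - 2 * Num.sqrt 2).
  have : `|x| <= (3 - 2 * Num.sqrt 2) * `|y| by rewrite -lx ler_pM2r.
  by clear -hx hy r0 rr r1 ny nx => *; nra.
have := h (`|x|^-1 *: x) (`|y|^-1 *: y) _ _ _ l.
rewrite (gtr0_norm l0) l1 l2 => /(_ _ _ _ isT).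
rewrite scalerA /l mulrAC divff ?gt_eqF // mul1r -scalerDr normrZ normfV normr_id.
rewrite [y + x]addrC.
have s0 : 0 < `|x + y| by lra.
rewrite ler_pdivrMr ?mulr_gt0 ?invr_gt0 // => hh.
have : 1 + `|x| / `|y| <= Num.sqrt 2 * (`|y|^-1 * `|x + y|).
  apply: hh; rewrite /unit_sphere /=.
  - by rewrite normrZ normfV normr_id mulVf ?gt_eqF.
  - by rewrite normrZ normfV normr_id mulVf ?gt_eqF.
  - move=> a.
    have -> : `|x|^-1 *: x + a *: (`|y|^-1 *: y) =
        `|x|^-1 *: (x + (`|x| * a / `|y|) *: y).
      by rewrite scalerDr !scalerA !mulrA mulVf ?gt_eqF // mul1r.
    by rewrite !(normrZ `|x|^-1) ler_pM2l ?hxy // normr_gt0 invr_eq0 gt_eqF.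
rewrite -(ler_pM2l ny) mulrDr mulr1 mulrCA divff ?gt_eqF // mulr1.
by rewrite mulrCA mulVKf ?gt_eqF // addrC.
Qed.

(** Dependent vectors are treated directly, because then [N] is not definite on the coordinate
    plane. *)
Lemma plane_quadratic (R : realType) (V : normedModType R) (x y : V) :
  (forall x y : V, birkhoff_james_orthogonal x y ->
    `|x| + `|y| <= Num.sqrt 2 * `|x + y|) ->
  exists A B C : R, forall a b : R,
    `|a *: x + b *: y| ^+ 2 = A * a ^+ 2 + B * (a * b) + C * b ^+ 2.
Proof.
move=> h.
have [[a [b [ab0 e]]]|hf] := pselect
    (exists a b : R, ((a != 0) || (b != 0)) /\ a *: x + b *: y = 0).
  have [a0|a0] := eqVneq a 0.
    have b0 : b != 0 by move: ab0; rewrite a0 eqxx.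
    have -> : y = 0.
      by move: e => /eqP; rewrite a0 scale0r add0r scaler_eq0 (negbTE b0) => /eqP.
    exists (`|x| ^+ 2), 0, 0 => c d; rewrite scaler0 addr0 normrZ exprMn real_normK ?num_real //.
    by ring.
  have -> : x = (- b / a) *: y.
    apply: (scalerI a0); rewrite scalerA mulrC divfK // scaleNr.
    by apply/eqP; rewrite -addr_eq0 e.
  set k := - b / a; exists (k ^+ 2 * `|y| ^+ 2), (2 * k * `|y| ^+ 2), (`|y| ^+ 2) => c d.
  rewrite scalerA -scalerDl normrZ exprMn real_normK ?num_real //.
  by ring.
pose N (a b : R) := `|a *: x + b *: y|.
have hN : norm2 N.
  split.
  - by move=> c a b; rewrite /N -normrZ scalerDr !scalerA.
  - by move=> a b c d; rewrite /N !scalerDl addrACA; exact: ler_normD.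
  - move=> a b /eqP; rewrite /N normr_eq0 => /eqP e.
    have [ab|] := boolP ((a != 0) || (b != 0)).
      by exfalso; apply: hf; exists a, b.
    by rewrite negb_or !negbK => /andP[/eqP -> /eqP ->].
apply: (rectangular_quadratic hN) => a b c d hb.
have := h (a *: x + b *: y) (c *: x + d *: y); rewrite addrACA -!scalerDl; apply.
by move=> s; rewrite scalerDr !scalerA addrACA -!scalerDl; exact: hb.
Qed.

(** Polarisation: the quadratic form on each plane gives the parallelogram law and, at once for all
    real scalars, the homogeneity of the polar form. *)
Lemma quadratic_inner_product (R : realType) (V : finNormedModType R) :
  (forall x y : V, exists A B C : R, forall a b : R,
    `|a *: x + b *: y| ^+ 2 = A * a ^+ 2 + B * (a * b) + C * b ^+ 2) ->
  is_inner_product_space V.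
Proof.
move=> h.
pose f (x : V) : R := `|x| ^+ 2.
pose form (x y : V) : R := (f (x + y) - f (x - y)) / 4.
have fN x : f (- x) = f x by rewrite /f normrN.
have par x y : f (x + y) + f (x - y) = 2 * f x + 2 * f y.
  have [A [B [C e]]] := h x y.
  have e1 := e 1 1; have e2 := e 1 (-1); have e3 := e 1 0; have e4 := e 0 1.
  rewrite !scale1r ?scale0r ?scaleN1r ?addr0 ?add0r in e1 e2 e3 e4.
  by rewrite /f e1 e2 e3 e4; ring.
have formC x y : form x y = form y x.
  by rewrite /form -(fN (y - x)) opprB [y + x]addrC.
have formZ a x y : form (a *: x) y = a * form x y.
  have [A [B [C e]]] := h x y.
  have e1 := e a 1; have e2 := e a (-1); have e3 := e 1 1; have e4 := e 1 (-1).
  rewrite !scale1r ?scaleN1r in e1 e2 e3 e4.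
  by rewrite /form /f e1 e2 e3 e4; field.
(* In the combination [p1 - p2 + p3 - p4] of parallelogram laws, the terms containing the difference
   of [x] and [x'] cancel by [q1] and [q2]. *)
have formD x x' y : form (x + x') y = form x y + form x' y.
  have p1 := par (x + y) x'; have p2 := par (x - y) x'.
  have p3 := par (x' + y) x; have p4 := par (x' - y) x.
  have q1 : f (x' + y - x) = f (x - y - x').
    by rewrite -fN opprB opprD addrA addrAC.
  have q2 : f (x' - y - x) = f (x + y - x') by rewrite -fN opprB opprB addrA.
  rewrite [x + y + x']addrAC in p1; rewrite [x - y + x']addrAC in p2.
  rewrite [x' + y + x]addrC addrA q1 in p3; rewrite [x' - y + x]addrC addrA q2 in p4.
  by rewrite /form; lra.
have formxx x : form x x = f x.
  rewrite /form subrr /f normr0 expr0n subr0 -mulr2n -scaler_nat normrZ normr_nat.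
  by field.
have hb : bilinear_for ( *%R : GRing.Scale.law R R) (idfun \; *%R : GRing.Scale.law R R) form.
  split=> [u' a u v|u a u' v'] /=.
    by rewrite formD formZ.
  by rewrite formC formD formZ ![form _ u]formC.
have hh (x y : V) : form x y = (-1) ^+ false * idfun (form y x).
  by rewrite expr0 mul1r formC.
have hp (x : V) : x != 0 -> 0 < form x x.
  by move=> x0; rewrite formxx exprn_gt0 // normr_gt0.
pose B1 := bilinear_isBilinear.Build R V V R _ _ form hb.
pose B2 := @isHermitianSesquilinear.Build R V false idfun form hh.
pose B3 := @isDotProduct.Build R V form hp.
pose dotp : {dot V for idfun} := HB.pack form B1 B2 B3.
exists dotp => x; rewrite /= formxx sqrtr_sqr normr_id.
by [].
Qed.

(** Birkhoff-James orthogonality becomes [D x y = 0], so the squared denominator is [1 + l ^+ 2],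
    and [(1 + |l|)^2 <= 2 (1 + l^2)]. *)
Lemma inner_product_condition (R : realType) (V : finNormedModType R) (x y : V) (l : R) :
  is_inner_product_space V -> unit_sphere V x -> unit_sphere V y ->
  birkhoff_james_orthogonal x y -> (1 + `|l|) / `|y + l *: x| <= Num.sqrt 2.
Proof.
move=> [D hD] x1 y1 hxy.
have sym u v : D u v = D v u.
  by have := @hermitian_subproof _ _ _ _ D u v; rewrite expr0 mul1r.
have D0 u : 0 <= D u u.
  have [->|u0] := eqVneq u 0; first by rewrite linear0l.
  by apply/ltW/neq0_dnorm_gt0.
have n2 (u : V) : `|u| ^+ 2 = D u u by rewrite hD sqr_sqrtr.
have expand (u v : V) (a : R) : D (u + a *: v) (u + a *: v) =
    D u u + 2 * a * D u v + a ^+ 2 * D v v.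
  have DZ b w w' : D (b *: w) w' = b * D w w' by exact: linearZl_LR.
  have DD w w' w'' : D (w + w') w'' = D w w'' + D w' w'' by exact: linearDl.
  rewrite DD DZ (sym u) (sym v) !DD !DZ (sym v u).
  by ring.
have dx : D x x = 1 by rewrite -n2 x1 expr1n.
have dy : D y y = 1 by rewrite -n2 y1 expr1n.
have o : D x y = 0.
  (* This scalar minimises the norm of [x + a *: y]; orthogonality there reads
     [1 <= 1 - D x y ^+ 2]. *)
  have := hxy (- D x y); rewrite -(@ler_pXn2r _ 2) ?nnegrE // !n2 expand dx dy => o1.
  by apply/eqP; rewrite -sqrf_eq0; apply/eqP; have := sqr_ge0 (D x y); nra.
have nl : `|y + l *: x| ^+ 2 = 1 + l ^+ 2 by rewrite n2 expand dx dy sym o; ring.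
have n0 : 0 < `|y + l *: x|.
  rewrite lt_neqAle normr_ge0 andbT; apply/eqP => e; move: nl; rewrite -e.
  by rewrite expr0n /=; have := sqr_ge0 l; lra.
rewrite ler_pdivrMr // -(@ler_pXn2r _ 2) ?nnegrE ?mulr_ge0 ?sqrtr_ge0 ?addr_ge0 //.
rewrite exprMn nl sqr_sqrtr // -(real_normK (num_real l)).
by have := sqr_ge0 (1 - `|l|); lra.
Qed.

Theorem theorem3p10 (R : realType) (V : finNormedModType R) :
  is_inner_product_space V <->
  (forall x y : V, unit_sphere V x -> unit_sphere V y ->
     birkhoff_james_orthogonal x y ->
     forall lambda : R,
       3 - 2 * Num.sqrt 2 < `|lambda| < Num.sqrt 2 + 1 ->
       (1 + `|lambda|) / `|y + lambda *: x| <= Num.sqrt 2).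
Proof.
split=> [hV x y hx hy hxy l _|h]; first exact: inner_product_condition.
apply: quadratic_inner_product => x y; apply: plane_quadratic.
exact: vector_rectangle.
Qed.
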